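(* Let $J\subseteq\mathbb{R}$ be an open interval and let $\kappa:J\to\mathbb{R}$, $\kappa=\kappa(v)$, be a continuous function. Then the problem of determining locally a spacelike ($\epsilon=1$) or timelike ($\epsilon=-1$) curve in $\mathbb{L}^2$ whose curvature is $\kappa(v)$, where $v=y-x$ is non constant and $|v|$ is the Lorentzian pseudodistance through the horizontal or vertical geodesics to the $u$-axis, with geometric linear momentum $\mathcal K=\mathcal K(v)$ satisfying $$-\epsilon\,d(1/\mathcal K)=\kappa(v)\,dv,$$ is solvable by quadratures, in the following sense. Fix $\epsilon\in\{1,-1\}$ and a nowhere vanishing function $\mathcal K=\mathcal K(v)$, defined on an open subinterval of $J$, such that $-\epsilon/\mathcal K(v)$ is an anti-derivative of $\kappa(v)$. Let $v(s)$ and $u(s)$ be obtained from $$ds=\epsilon\,\mathcal K(v)\,dv,\qquad du=\mathcal K(v)\,ds,$$ by integrating the first equation to get $s=s(v)$, inverting to get $v=v(s)$, and integrating the second to get $u=u(s)$. Then the curve with coordinates $(u(s),v(s))$ is a unit-speed curve, spacelike if $\epsilon=1$ and timelike if $\epsilon=-1$, with curvature $\kappa(v(s))$ and geometric linear momentum $\mathcal K(v(s))$. Moreover, such a curve is uniquely determined by $\mathcal K(v)$ up to a translation in the $u$-direction (and a translation of the arc parameter $s$): any unit-speed curve of causal character $\epsilon$ with geometric linear momentum $\mathcal K(v)$ is locally obtained by this procedure.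
   Context: $\mathbb{L}^2=(\mathbb{R}^2,g=-dx^2+dy^2)$ is the Lorentz-Minkowski plane with rectangular coordinates $(x,y)$. A curve $\gamma=(x,y)$ is spacelike (resp. timelike) if $g(\gamma',\gamma')>0$ (resp. $<0$) everywhere. It is unit-speed if $g(\dot\gamma,\dot\gamma)=\epsilon$ with $\epsilon=1$ (spacelike) or $\epsilon=-1$ (timelike); the dot is the derivative with respect to the arc parameter $s$. For a unit-speed curve put $T=\dot\gamma=(\dot x,\dot y)$ and $N=(\dot y,\dot x)$; the (signed) curvature $\kappa$ is defined by $\dot T=\kappa N$, i.e. $\kappa=\epsilon(\ddot x\dot y-\dot x\ddot y)$. Coordinates $(u,v)$ on $\mathbb{L}^2$ are defined by $u=y+x$, $v=y-x$, so that $g=du\,dv$ and unit speed means $\dot u\,\dot v=\epsilon$. The $u$-axis is the lightlike geodesic $x=y$. For points $P,Q$, the Lorentzian pseudodistance is $\delta(P,Q)=\sqrt{|g(\overrightarrow{PQ},\overrightarrow{PQ})|}$; $|v|=|y-x|$ equals $\delta(P,P')$ where $P=(x,y)$ and $P'$ is the intersection with the line $x=y$ of the horizontal (or the vertical) line through $P$. The geometric linear momentum (with respect to the $u$-axis) of a unit-speed curve is $\mathcal K(s)=\dot u(s)$. *)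

(* Defs.v *)
From Stdlib Require Import Reals.
From Coquelicot Require Import Coquelicot.
Open Scope R_scope.

(* Nonempty open intervals, possibly unbounded, as predicates on R. *)
Definition is_open_interval (I : R -> Prop) : Prop :=
  exists a b : Rbar, Rbar_lt a b /\
    forall t : R, I t <-> (Rbar_lt a t /\ Rbar_lt t b).

Definition subset (A B : R -> Prop) : Prop := forall t : R, A t -> B t.

(* Points and vectors of the Lorentz-Minkowski plane are pairs (x, y). *)
Definition plane : Type := (R * R)%type.

Definition g (p q : plane) : R := - (fst p * fst q) + snd p * snd q.

Definition delta (P Q : plane) : R :=
  let PQ := (fst Q - fst P, snd Q - snd P) in sqrt (Rabs (g PQ PQ)).

Definition u_coord (p : plane) : R := snd p + fst p.
Definition v_coord (p : plane) : R := snd p - fst p.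

Definition on_u_axis (p : plane) : Prop := fst p = snd p.
Definition same_horizontal (p q : plane) : Prop := snd p = snd q.
Definition same_vertical (p q : plane) : Prop := fst p = fst q.

Definition curve_of_uv (u v : R -> R) (s : R) : plane :=
  ((u s - v s) / 2, (u s + v s) / 2).

Definition translate_u (d : R) (p : plane) : plane := (fst p + d, snd p + d).

Definition differentiable_curve_at (gam : R -> plane) (s : R) : Prop :=
  ex_derive (fun t => fst (gam t)) s /\ ex_derive (fun t => snd (gam t)) s.

Definition velocity (gam : R -> plane) (s : R) : plane :=
  (Derive (fun t => fst (gam t)) s, Derive (fun t => snd (gam t)) s).

Definition normal (gam : R -> plane) (s : R) : plane :=
  (snd (velocity gam s), fst (velocity gam s)).

Definition spacelike_on (I : R -> Prop) (gam : R -> plane) : Prop :=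
  forall s, I s -> differentiable_curve_at gam s /\
    g (velocity gam s) (velocity gam s) > 0.

Definition timelike_on (I : R -> Prop) (gam : R -> plane) : Prop :=
  forall s, I s -> differentiable_curve_at gam s /\
    g (velocity gam s) (velocity gam s) < 0.

Definition unit_speed_on (eps : R) (I : R -> Prop) (gam : R -> plane) : Prop :=
  forall s, I s -> differentiable_curve_at gam s /\
    g (velocity gam s) (velocity gam s) = eps.

(* For a unit-speed curve the normal is never zero, so k is unique. *)
Definition has_curvature_at (gam : R -> plane) (s k : R) : Prop :=
  differentiable_curve_at (velocity gam) s /\
  velocity (velocity gam) s = (k * fst (normal gam s), k * snd (normal gam s)).

Definition momentum (gam : R -> plane) (s : R) : R :=
  Derive (fun t => u_coord (gam t)) s.

Definition antiderivative_on (A : R -> Prop) (f F : R -> R) : Prop :=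
  forall t, A t -> is_derive F t (f t).

(* f maps A bijectively onto B, with inverse h. *)
Definition inverse_on (A B : R -> Prop) (f h : R -> R) : Prop :=
  (forall w, A w -> B (f w) /\ h (f w) = w) /\
  (forall s, B s -> A (h s) /\ f (h s) = s).

(* K is nowhere zero on the open subinterval J' of J, and
   - eps d(1/K) = kappa dv there. *)
Definition momentum_function (eps : R) (J : R -> Prop) (kappa : R -> R)
    (J' : R -> Prop) (K : R -> R) : Prop :=
  is_open_interval J' /\ subset J' J /\
  (forall w, J' w -> K w <> 0) /\
  antiderivative_on J' kappa (fun w => - eps / K w).

(* ds = eps K(v) dv on J', inverted to v : I -> J', then du = K(v) ds on I. *)
Definition quadratures (eps : R) (K : R -> R) (J' I : R -> Prop)
    (S u v : R -> R) : Prop :=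
  antiderivative_on J' (fun w => eps * K w) S /\
  inverse_on J' I S v /\
  antiderivative_on I (fun s => K (v s)) u.

(* A unit-speed curve on I, of causal character eps, whose momentum is the
   function K of v; K is only meaningful on J'. *)
Definition curve_with_momentum (eps : R) (K : R -> R) (J' I : R -> Prop)
    (gam : R -> plane) : Prop :=
  unit_speed_on eps I gam /\
  (eps = 1 -> spacelike_on I gam) /\
  (eps = -1 -> timelike_on I gam) /\
  (forall s, I s -> J' (v_coord (gam s)) /\
     momentum gam s = K (v_coord (gam s))).

(* Main.v *)
(* In the coordinates (u, v) unit speed reads u' v' = eps, so a curve has
   momentum K(v) exactly when u' = K(v) and v' = eps / K(v).  The second
   equation says that s -> v is a local inverse of an antiderivative S of
   eps K; K has constant sign, so S is strictly monotone and its inverse is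
   defined on an open interval.  The equation d(1/K) = - eps kappa dv gives
   K' = eps kappa K^2, hence u'' = kappa u' and v'' = - kappa v', which is
   T' = kappa N since N has coordinates (u', - v'). *)

Require Import Defs.
From Stdlib Require Import Reals.
From Coquelicot Require Import Coquelicot.
From Stdlib Require Import Ranalysis5 Lra Classical ClassicalEpsilon.
Open Scope R_scope.

(** * Open intervals of the real line *)

Lemma open_interval_convex (A : R -> Prop) (a b t : R) :
  is_open_interval A -> A a -> A b -> a <= t <= b -> A t.
Proof.
  intros [l [r [_ HA]]] Ha Hb Ht.
  apply HA in Ha; apply HA in Hb; apply HA.
  destruct l, r; simpl in *; intuition lra.
Qed.

Lemma open_interval_open (A : R -> Prop) : is_open_interval A -> open A.
Proof.
  intros [l [r [_ HA]]].
  apply open_ext with (fun t : R => Rbar_lt l t /\ Rbar_lt t r).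
  - intros t; symmetry; apply HA.
  - apply open_and; [apply open_Rbar_gt | apply open_Rbar_lt].
Qed.

Lemma open_interval_inhabited (A : R -> Prop) :
  is_open_interval A -> exists t, A t.
Proof.
  intros [l [r [Hlr HA]]].
  destruct l as [l | |], r as [r | |]; simpl in Hlr; try easy.
  - exists ((l + r) / 2); apply HA; simpl; lra.
  - exists (l + 1); apply HA; simpl; lra.
  - exists (r - 1); apply HA; simpl; lra.
  - exists 0; apply HA; simpl; lra.
Qed.

Lemma open_radius (A : R -> Prop) (t : R) :
  open A -> A t ->
  exists e : posreal, forall x, t - e <= x <= t + e -> A x.
Proof.
  intros HA Ht.
  destruct (HA t Ht) as [e He].
  (* Halving the radius of the open ball makes room for a closed interval. *)
  exists (pos_div_2 e); intros x Hx; apply He.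
  change (Rabs (x - t) < e); simpl in Hx.
  pose proof (cond_pos e); apply Rabs_def1; lra.
Qed.

(** The endpoints are the infimum and supremum in the extended reals, which covers unbounded sets.
    Openness makes both bounds strict, and the given member [t] separates them. *)
Lemma open_interval_intro (A : R -> Prop) (t : R) :
  A t -> open A ->
  (forall a b x, A a -> A b -> a <= x <= b -> A x) ->
  is_open_interval A.
Proof.
  intros Ht HA Hconv.
  destruct (Lub_Rbar_correct A) as [Hub Hlub].
  destruct (Glb_Rbar_correct A) as [Hlb Hglb].
  assert (Hin : forall x, A x ->
      Rbar_lt (Glb_Rbar A) x /\ Rbar_lt x (Lub_Rbar A)).
  { intros x Hx.
    destruct (open_radius A x HA Hx) as [e He]; pose proof (cond_pos e).
    split.
    - apply Rbar_le_lt_trans with (Finite (x - e)); [| simpl; lra].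
      apply Hlb, He; lra.
    - apply Rbar_lt_le_trans with (Finite (x + e)); [simpl; lra |].
      apply Hub, He; lra. }
  exists (Glb_Rbar A), (Lub_Rbar A); split.
  { apply Rbar_lt_trans with t; apply Hin, Ht. }
  intros x; split; [apply Hin |].
  intros [Hl Hr].
  (* Otherwise [x] would be a lower bound of [A], hence at most the infimum. The mirror argument
     gives [b], and convexity then puts [x] in [A]. *)
  assert (Ha : exists a, A a /\ a <= x).
  { apply NNPP; intros Hn.
    apply (Rbar_lt_not_le _ _ Hl), Hglb; intros y Hy; simpl.
    apply Rnot_lt_le; intros Hyx; apply Hn; exists y; split; [easy | lra]. }
  assert (Hb : exists b, A b /\ x <= b).
  { apply NNPP; intros Hn.
    apply (Rbar_lt_not_le _ _ Hr), Hlub; intros y Hy; simpl.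
    apply Rnot_lt_le; intros Hyx; apply Hn; exists y; split; [easy | lra]. }
  destruct Ha as [a [Ha Hax]], Hb as [b [Hb Hxb]].
  apply (Hconv a b); easy.
Qed.

Lemma ball_open_interval (t : R) (e : posreal) :
  is_open_interval (fun x => t - e < x < t + e).
Proof.
  exists (Finite (t - e)), (Finite (t + e)); split; [| easy].
  pose proof (cond_pos e); simpl; lra.
Qed.

(** * Intermediate values, constant sign and antiderivatives *)

Lemma intermediate_value (f : R -> R) (a b y : R) :
  a <= b -> (forall x, a <= x <= b -> continuous f x) ->
  Rmin (f a) (f b) <= y <= Rmax (f a) (f b) ->
  exists x, a <= x <= b /\ f x = y.
Proof.
  intros Hab Hf Hy.
  destruct (Req_dec (f a) y) as [Ha | Ha]; [exists a; split; [lra | easy] |].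
  destruct (Req_dec (f b) y) as [Hb | Hb]; [exists b; split; [lra | easy] |].
  assert (Hlt : a < b).
  { destruct Hab as [| ->]; [easy |].
    rewrite Rmin_left, Rmax_left in Hy; lra. }
  (* [IVT_interv] takes a function that is negative on the left and positive on the right: [f - y]
     or [y - f], according to the order of [f a] and [f b]. Both have the form [c * f + k]. *)
  assert (Hc : forall c k z, a <= z <= b ->
      continuity_pt (fun x => c * f x + k) z).
  { intros c k z Hz; apply continuity_pt_filterlim.
    apply (continuous_plus (fun x => c * f x)); [| apply continuous_const].
    apply (continuous_scal_r c f), Hf, Hz. }
  destruct (Rle_lt_dec (f a) (f b)) as [Hle | Hle].
  - rewrite Rmin_left, Rmax_right in Hy by lra.
    destruct (IVT_interv (fun x => 1 * f x + - y) a b) as [x [Hx Hfx]];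
      [apply Hc | easy | lra | lra |].
    exists x; split; lra.
  - rewrite Rmin_right, Rmax_left in Hy by lra.
    destruct (IVT_interv (fun x => -1 * f x + y) a b) as [x [Hx Hfx]];
      [apply Hc | easy | lra | lra |].
    exists x; split; lra.
Qed.

(** A change of sign would force a zero in between. The sign is returned as a factor [sg], so that
    the increasing and decreasing cases can later be handled together. *)
Lemma nonvanishing_constant_sign (A : R -> Prop) (f : R -> R) :
  is_open_interval A -> (forall t, A t -> continuous f t) ->
  (forall t, A t -> f t <> 0) ->
  exists sg, (sg = 1 \/ sg = -1) /\ forall t, A t -> 0 < sg * f t.
Proof.
  intros HA Hf Hnz.
  assert (Hsame : forall a b, A a -> A b -> a <= b -> 0 < f a * f b).
  { intros a b Ha Hb Hab.
    apply Rnot_le_lt; intros Hle.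
    destruct (intermediate_value f a b 0) as [x [Hx Hfx]]; [easy | | |].
    - intros x Hx; apply Hf, (open_interval_convex A a b); easy.
    - unfold Rmin, Rmax; destruct Rle_dec; split; nra.
    - apply (Hnz x); [apply (open_interval_convex A a b) |]; easy. }
  destruct (open_interval_inhabited A HA) as [t Ht].
  destruct (Rlt_le_dec 0 (f t)) as [Hp | Hp].
  - exists 1; split; [now left |]; intros x Hx.
    destruct (Rle_dec x t) as [Hxt | Hxt].
    + pose proof (Hsame x t Hx Ht Hxt); nra.
    + pose proof (Hsame t x Ht Hx ltac:(lra)); nra.
  - exists (-1); split; [now right |]; intros x Hx.
    pose proof (Hnz t Ht).
    destruct (Rle_dec x t) as [Hxt | Hxt].
    + pose proof (Hsame x t Hx Ht Hxt); nra.
    + pose proof (Hsame t x Ht Hx ltac:(lra)); nra.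
Qed.

Lemma antiderivative_continuous (A : R -> Prop) (f F : R -> R) (t : R) :
  antiderivative_on A f F -> A t -> continuous F t.
Proof.
  intros HF Ht; apply (ex_derive_continuous F); eexists; apply HF, Ht.
Qed.

(** The intermediate point is only located in [A], since the uses below need just the sign or the
    vanishing of [f] there. *)
Lemma antiderivative_mean_value (A : R -> Prop) (f F : R -> R) (a b : R) :
  is_open_interval A -> antiderivative_on A f F -> A a -> A b -> a <= b ->
  exists c, A c /\ F b - F a = f c * (b - a).
Proof.
  intros HA HF Ha Hb Hab.
  assert (Hin : forall x, Rmin a b <= x <= Rmax a b -> A x).
  { intros x; rewrite Rmin_left, Rmax_right by easy.
    apply (open_interval_convex A a b); easy. }
  destruct (MVT_gen F a b f) as [c [Hc HFc]].
  - intros x Hx; apply HF, Hin; lra.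
  - intros x Hx; apply continuity_pt_filterlim.
    apply (antiderivative_continuous A f F); auto.
  - exists c; auto.
Qed.

Lemma antiderivative_zero_constant (A : R -> Prop) (F : R -> R) :
  is_open_interval A -> antiderivative_on A (fun _ => 0) F ->
  exists c, forall t, A t -> F t = c.
Proof.
  intros HA HF.
  destruct (open_interval_inhabited A HA) as [a Ha].
  exists (F a); intros t Ht.
  destruct (Rle_dec a t) as [H | H].
  - destruct (antiderivative_mean_value A _ F a t HA HF) as [c [_ E]]; auto.
    lra.
  - destruct (antiderivative_mean_value A _ F t a HA HF) as [c [_ E]]; auto;
      lra.
Qed.

Lemma antiderivative_strict_mono (A : R -> Prop) (f F : R -> R) (sg a b : R) :
  is_open_interval A -> antiderivative_on A f F ->
  (forall t, A t -> 0 < sg * f t) -> A a -> A b -> a < b ->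
  0 < sg * (F b - F a).
Proof.
  intros HA HF Hpos Ha Hb Hab.
  destruct (antiderivative_mean_value A f F a b) as [c [Hc E]];
    [easy | easy | easy | easy | lra |].
  rewrite E; specialize (Hpos c Hc); nra.
Qed.

Lemma continuous_antiderivative (A : R -> Prop) (f : R -> R) (a : R) :
  is_open_interval A -> (forall t, A t -> continuous f t) -> A a ->
  antiderivative_on A f (fun t => RInt f a t).
Proof.
  intros HA Hf Ha t Ht.
  apply (is_derive_RInt f (fun t => RInt f a t) a t); [| apply Hf, Ht].
  apply (filter_imp A); [| apply open_interval_open; easy].
  intros b Hb; apply (RInt_correct f), (ex_RInt_continuous f).
  intros z; unfold Rmin, Rmax; destruct Rle_dec; intros Hz; apply Hf.
  - apply (open_interval_convex A a b); easy.
  - apply (open_interval_convex A b a); easy.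
Qed.

(** * Inverse function theorem for an antiderivative of a function of constant sign *)

Section Inversion.

Variables (A : R -> Prop) (f F : R -> R) (sg : R).
Hypothesis HA : is_open_interval A.
Hypothesis HF : antiderivative_on A f F.
Hypothesis Hsg : sg = 1 \/ sg = -1.
Hypothesis Hpos : forall t, A t -> 0 < sg * f t.

Lemma strict_mono_inverse_exists :
  exists h, inverse_on A (fun s => exists w, A w /\ F w = s) F h.
Proof.
  (* A preimage is picked by choice; outside the image of [F] the value is arbitrary. Strict
     monotonicity makes the pick the only possible one. *)
  exists (fun s => epsilon (inhabits 0) (fun w => A w /\ F w = s)).
  split.
  - intros w Hw; split; [exists w; easy |].
    destruct (epsilon_spec (inhabits 0) (fun w' => A w' /\ F w' = F w))
      as [Hw' E]; [exists w; easy |].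
    set (w' := epsilon _ _) in *.
    destruct (Rtotal_order w' w) as [H | [H | H]]; [exfalso | easy | exfalso].
    + pose proof (antiderivative_strict_mono A f F sg w' w HA HF Hpos
        Hw' Hw H) as M; rewrite E in M; lra.
    + pose proof (antiderivative_strict_mono A f F sg w w' HA HF Hpos
        Hw Hw' H) as M; rewrite E in M; lra.
  - intros s Hs; apply (epsilon_spec (inhabits 0) (fun w => A w /\ F w = s)).
    exact Hs.
Qed.

Variables (B : R -> Prop) (h : R -> R).
Hypothesis Hinv : inverse_on A B F h.

Lemma preimage_between (a b y : R) :
  A a -> A b -> a <= b -> Rmin (F a) (F b) <= y <= Rmax (F a) (F b) ->
  B y /\ a <= h y <= b.
Proof.
  intros Ha Hb Hab Hy.
  destruct (intermediate_value F a b y) as [x [Hx E]]; [easy | | easy |].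
  - intros x Hx; apply (antiderivative_continuous A f F); [easy |].
    apply (open_interval_convex A a b); easy.
  - assert (Hxa : A x) by (apply (open_interval_convex A a b); easy).
    destruct (proj1 Hinv x Hxa) as [HB E']; subst y; rewrite E'; easy.
Qed.

(** Openness of [B] and continuity of [h] come from one fact: [F] maps a small interval around [h s]
    onto an interval with [s] in its interior. *)
Lemma inverse_neighbourhood (s : R) (e : posreal) :
  B s -> locally s (fun t => B t /\ Rabs (h t - h s) <= e).
Proof.
  intros Hs.
  destruct (proj2 Hinv s Hs) as [Hw E].
  destruct (open_radius A (h s) (open_interval_open A HA) Hw) as [r Hr].
  pose proof (cond_pos e) as He; pose proof (cond_pos r) as Hr0.
  set (d := Rmin e r).
  assert (Hd : 0 < d <= e /\ d <= r).
  { unfold d; pose proof (Rmin_l e r); pose proof (Rmin_r e r).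
    repeat split; [apply Rmin_case | |]; easy. }
  assert (Hl : A (h s - d)) by (apply Hr; lra).
  assert (Hu : A (h s + d)) by (apply Hr; lra).
  pose proof (antiderivative_strict_mono A f F sg (h s - d) (h s)
    HA HF Hpos Hl Hw ltac:(lra)) as M1.
  pose proof (antiderivative_strict_mono A f F sg (h s) (h s + d)
    HA HF Hpos Hw Hu ltac:(lra)) as M2.
  rewrite E in M1, M2.
  (* The radius is the distance from [s] to the nearer image of the two ends; the factor [sg] makes
     both differences positive. *)
  assert (Hp : 0 < Rmin (sg * (s - F (h s - d))) (sg * (F (h s + d) - s)))
    by (apply Rmin_case; easy).
  exists (mkposreal _ Hp); intros t Ht.
  change (Rabs (t - s) <
    Rmin (sg * (s - F (h s - d))) (sg * (F (h s + d) - s))) in Ht.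
  pose proof (Rmin_l (sg * (s - F (h s - d))) (sg * (F (h s + d) - s))).
  pose proof (Rmin_r (sg * (s - F (h s - d))) (sg * (F (h s + d) - s))).
  apply Rabs_def2 in Ht.
  destruct (preimage_between (h s - d) (h s + d) t) as [HB Hh];
    [easy | easy | lra | |].
  - unfold Rmin, Rmax; destruct Rle_dec; destruct Hsg as [-> | ->]; lra.
  - split; [easy |]; apply Rabs_le; lra.
Qed.

Lemma inverse_domain_open_interval : is_open_interval B.
Proof.
  destruct (open_interval_inhabited A HA) as [w Hw].
  apply (open_interval_intro B (F w)).
  - apply (proj1 Hinv); easy.
  - intros s Hs.
    apply (filter_imp _ _ (fun t H => proj1 H)
      (inverse_neighbourhood s (mkposreal 1 Rlt_0_1) Hs)).
  - intros a b x Ha Hb Hx.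
    destruct (proj2 Hinv a Ha) as [Ha' Ea], (proj2 Hinv b Hb) as [Hb' Eb].
    destruct (Rle_dec (h a) (h b)) as [H | H].
    + apply (preimage_between (h a) (h b)); try easy.
      rewrite Ea, Eb, Rmin_left, Rmax_right; lra.
    + apply (preimage_between (h b) (h a)); try easy; [lra |].
      rewrite Ea, Eb, Rmin_right, Rmax_left; lra.
Qed.

Lemma inverse_continuous (s : R) : B s -> continuous h s.
Proof.
  intros Hs; apply filterlim_locally; intros e.
  apply (filter_imp (fun t => B t /\ Rabs (h t - h s) <= pos_div_2 e));
    [| apply inverse_neighbourhood; easy].
  intros t [_ Ht]; change (Rabs (h t - h s) < e).
  pose proof (cond_pos e); simpl in Ht; lra.
Qed.

(** With [k = h (s + x) - h s], the increment [x] equals [F (h s + k) - F (h s)], so the quotient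
    [k / x] is the inverse of a difference quotient of [F]. *)
Lemma inverse_derivative : antiderivative_on B (fun s => / f (h s)) h.
Proof.
  intros s Hs.
  destruct (proj2 Hinv s Hs) as [Hw E].
  assert (Hf : f (h s) <> 0) by (specialize (Hpos _ Hw); nra).
  pose proof (HF _ Hw) as D; apply is_derive_Reals in D.
  apply is_derive_Reals; intros e He.
  assert (Hc : continuous Rinv (f (h s)))
    by (apply continuity_pt_filterlim, continuity_pt_inv;
        [apply derivable_continuous_pt, derivable_pt_id | easy]).
  (* The radii are chained: [r] from continuity of inversion, [d] from the derivative of [F] at
     [h s], [m] from continuity of [h]. *)
  destruct (proj1 (filterlim_locally _ _) Hc (mkposreal e He)) as [r Hr].
  destruct (D r (cond_pos r)) as [d Hd].
  destruct (inverse_neighbourhood s (pos_div_2 d) Hs) as [m Hm].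
  exists m; intros x Hx Hxm.
  destruct (Hm (s + x)) as [HB Hk].
  { change (Rabs (s + x - s) < m); now replace (s + x - s) with x by ring. }
  set (k := h (s + x) - h s) in *.
  destruct (proj2 Hinv _ HB) as [_ E'].
  replace (h (s + x)) with (h s + k) in E' by (unfold k; ring).
  (* If [k] vanished, [F (h s)] would equal both [s] and [s + x]. *)
  assert (Hk0 : k <> 0).
  { intros H0; rewrite H0, Rplus_0_r in E'; lra. }
  specialize (Hd k Hk0); rewrite E', E in Hd.
  replace (s + x - s) with x in Hd by ring.
  assert (Hq : ball (f (h s)) r (x / k)).
  { apply Hd; pose proof (cond_pos d); simpl in Hk; lra. }
  apply Hr in Hq; change (Rabs (/ (x / k) - / f (h s)) < e) in Hq.
  now replace (k / x) with (/ (x / k)) by (field; easy).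
Qed.

End Inversion.

(** * Null coordinates, the pseudodistance and existence of a momentum function *)

Lemma curve_of_uv_derive (u v : R -> R) (s a b : R) :
  is_derive u s a -> is_derive v s b ->
  differentiable_curve_at (curve_of_uv u v) s /\
  velocity (curve_of_uv u v) s = ((a - b) / 2, (a + b) / 2).
Proof.
  intros Hu Hv.
  assert (Hx : is_derive (fun t => fst (curve_of_uv u v t)) s ((a - b) / 2)).
  { unfold curve_of_uv; simpl; auto_derive.
    - repeat split; eexists; eassumption.
    - rewrite (is_derive_unique (fun x : R => u x) _ _ Hu),
        (is_derive_unique (fun x : R => v x) _ _ Hv); field. }
  assert (Hy : is_derive (fun t => snd (curve_of_uv u v t)) s ((a + b) / 2)).
  { unfold curve_of_uv; simpl; auto_derive.
    - repeat split; eexists; eassumption.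
    - rewrite (is_derive_unique (fun x : R => u x) _ _ Hu),
        (is_derive_unique (fun x : R => v x) _ _ Hv); field. }
  split; [split; eexists; eassumption |].
  unfold velocity; f_equal; apply is_derive_unique; assumption.
Qed.

Lemma u_coord_curve_of_uv (u v : R -> R) (s : R) :
  u_coord (curve_of_uv u v s) = u s.
Proof. unfold u_coord, curve_of_uv; simpl; field. Qed.

Lemma v_coord_curve_of_uv (u v : R -> R) (s : R) :
  v_coord (curve_of_uv u v s) = v s.
Proof. unfold v_coord, curve_of_uv; simpl; field. Qed.

(** The displacement from [P] to [P'] has one zero component and the other equal to [y - x] up to
    sign, so its square under [g] is minus or plus [(y - x)^2]. *)
Lemma pseudodistance_to_u_axis (P P' : plane) :
  on_u_axis P' -> same_horizontal P P' \/ same_vertical P P' ->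
  Rabs (v_coord P) = delta P P'.
Proof.
  destruct P as [x y], P' as [a b].
  unfold on_u_axis, same_horizontal, same_vertical, v_coord, delta, g; simpl.
  intros -> [<- | <-].
  - replace (- ((y - x) * (y - x)) + (y - y) * (y - y)) with (- Rsqr (y - x))
      by (unfold Rsqr; ring).
    rewrite Rabs_Ropp, (Rabs_pos_eq (Rsqr _)) by apply Rle_0_sqr.
    symmetry; apply sqrt_Rsqr_abs.
  - replace (- ((x - x) * (x - x)) + (x - y) * (x - y)) with (Rsqr (y - x))
      by (unfold Rsqr; ring).
    rewrite (Rabs_pos_eq (Rsqr _)) by apply Rle_0_sqr.
    symmetry; apply sqrt_Rsqr_abs.
Qed.

(** Solving [- eps / K = F] for an antiderivative [F] of [kappa] gives [K]. The additive constant is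
    chosen so that [F v0 = 1]; near [v0], [F] stays positive and [K] is a genuine nonzero
    quotient. *)
Lemma momentum_function_exists (eps : R) (J : R -> Prop) (kappa : R -> R)
    (v0 : R) :
  eps = 1 \/ eps = -1 -> is_open_interval J ->
  (forall w, J w -> continuous kappa w) -> J v0 ->
  exists (J' : R -> Prop) (K : R -> R),
    J' v0 /\ momentum_function eps J kappa J' K.
Proof.
  intros Heps HJ Hk H0.
  set (F := fun w => 1 + RInt kappa v0 w).
  assert (HF : antiderivative_on J kappa F).
  { intros w Hw; unfold F.
    replace (kappa w) with (0 + kappa w) by ring.
    apply (is_derive_plus (fun _ => 1)); [apply @is_derive_const |].
    apply (continuous_antiderivative J); easy. }
  assert (HF0 : F v0 = 1).
  { unfold F; rewrite RInt_point; apply Rplus_0_r. }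
  assert (Hloc : locally v0 (fun w => J w /\ 0 < F w)).
  { apply filter_and; [apply open_interval_open; easy |].
    apply (antiderivative_continuous J kappa F v0 HF H0 (fun y => 0 < y)).
    apply (open_gt 0); rewrite HF0; lra. }
  destruct Hloc as [e He].
  exists (fun x => v0 - e < x < v0 + e), (fun w => / (- eps * F w)).
  assert (Hin : forall x, v0 - e < x < v0 + e -> J x /\ 0 < F x).
  { intros x Hx; apply He; change (Rabs (x - v0) < e); apply Rabs_def1; lra. }
  split; [pose proof (cond_pos e); lra |].
  split; [apply ball_open_interval |].
  split; [intros x Hx; apply Hin, Hx |].
  split.
  - intros x Hx; apply Hin in Hx; apply Rinv_neq_0_compat.
    destruct Heps; nra.
  (* The identity [F w = - eps / K w] holds for every real [w], even where [F] vanishes, because the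
     inverse of zero is zero. *)
  - intros x Hx; apply (is_derive_ext F); [| apply HF, Hin, Hx].
    intros w; change (F w = - eps / / (- eps * F w)).
    unfold Rdiv; rewrite Rinv_inv; destruct Heps as [-> | ->]; ring.
Qed.

(** * Curves built from a momentum function by quadratures *)

Section Momentum.

Variables (eps : R) (J : R -> Prop) (kappa : R -> R) (J' : R -> Prop).
Variable K : R -> R.
Hypothesis Heps : eps = 1 \/ eps = -1.
Hypothesis HK : momentum_function eps J kappa J' K.

Let Hneq0 (w : R) : J' w -> K w <> 0.
Proof. apply HK. Qed.

(** Only [- eps / K] is known to be differentiable, so [K] is recovered from it as
    [- eps / (- eps / K)]. This rewriting is valid at every real, zeros of [K] included, by the
    convention on the inverse of zero. *)
Lemma momentum_function_derive :
  antiderivative_on J' (fun w => eps * kappa w * (K w * K w)) K.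
Proof.
  intros w Hw.
  assert (Hd : is_derive (fun w => - eps / K w) w (kappa w)) by apply HK, Hw.
  pose proof (Hneq0 w Hw) as Hn.
  apply (is_derive_ext (fun w => - eps / (- eps / K w))).
  { intros t; change (- eps / (- eps / K t) = K t).
    unfold Rdiv; rewrite Rinv_mult, Rinv_inv.
    destruct Heps as [-> | ->]; field. }
  set (F := fun w => - eps / K w) in Hd.
  apply (is_derive_ext (fun w => - eps / F w)); [reflexivity |].
  auto_derive.
  - repeat split; [eexists; exact Hd |].
    unfold F, Rdiv; apply Rmult_integral_contrapositive_currified.
    + destruct Heps; lra.
    + apply Rinv_neq_0_compat; easy.
  - rewrite (is_derive_unique (fun x : R => F x) _ _ Hd); unfold F.
    destruct Heps as [-> | ->]; field; easy.
Qed.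

Lemma momentum_function_continuous (w : R) : J' w -> continuous K w.
Proof.
  apply antiderivative_continuous with (1 := momentum_function_derive).
Qed.

Lemma momentum_function_sign :
  exists sg, (sg = 1 \/ sg = -1) /\ forall w, J' w -> 0 < sg * (eps * K w).
Proof.
  apply (nonvanishing_constant_sign J' (fun w => eps * K w)).
  - apply HK.
  - intros w Hw; apply (continuous_scal_r eps K).
    apply momentum_function_continuous, Hw.
  - intros w Hw; pose proof (Hneq0 w Hw); destruct Heps; nra.
Qed.

Lemma arc_parameter_exists :
  exists S, antiderivative_on J' (fun w => eps * K w) S.
Proof.
  destruct (open_interval_inhabited J') as [a Ha]; [apply HK |].
  eexists; apply (continuous_antiderivative J' _ a); [apply HK | | exact Ha].
  intros w Hw; apply (continuous_scal_r eps K).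
  apply momentum_function_continuous, Hw.
Qed.

(** [I] is the image of [J'] under [S], [v] the inverse of [S], and [u] an integral of the
    continuous function [K (v t)] from a base point of [I]. *)
Lemma quadratures_exist (S : R -> R) :
  antiderivative_on J' (fun w => eps * K w) S ->
  exists (I : R -> Prop) (u v : R -> R), quadratures eps K J' I S u v.
Proof.
  intros HS.
  destruct momentum_function_sign as [sg [Hsg Hpos]].
  assert (HJ' : is_open_interval J') by apply HK.
  destruct (strict_mono_inverse_exists J' _ S sg HJ' HS Hpos) as [v Hv].
  set (I := fun s => exists w, J' w /\ S w = s) in Hv.
  assert (HI : is_open_interval I)
    by (apply (inverse_domain_open_interval J' _ S sg HJ' HS Hsg Hpos I v Hv)).
  destruct (open_interval_inhabited I HI) as [s0 Hs0].
  exists I, (fun s => RInt (fun t => K (v t)) s0 s), v.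
  split; [exact HS |]; split; [exact Hv |].
  apply continuous_antiderivative; [exact HI | | exact Hs0].
  intros s Hs; apply (continuous_comp v K).
  - apply (inverse_continuous J' _ S sg HJ' HS Hsg Hpos I v Hv s Hs).
  - apply momentum_function_continuous, (proj2 Hv s Hs).
Qed.

(** This reduces the procedure to the system [u' = K(v)], [v' = eps / K(v)]; the second equation is
    the inverse function theorem, as [1 / eps = eps]. *)
Lemma quadratures_derive (I : R -> Prop) (S u v : R -> R) :
  quadratures eps K J' I S u v ->
  is_open_interval I /\ (forall s, I s -> J' (v s)) /\
  antiderivative_on I (fun s => K (v s)) u /\
  antiderivative_on I (fun s => eps / K (v s)) v.
Proof.
  intros [HS [Hv Hu]].
  destruct momentum_function_sign as [sg [Hsg Hpos]].
  assert (HJ' : is_open_interval J') by apply HK.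
  split; [exact (inverse_domain_open_interval J' _ S sg HJ' HS Hsg Hpos I v Hv) |].
  split; [intros s Hs; apply (proj2 Hv s Hs) |].
  split; [exact Hu |].
  intros s Hs.
  replace (eps / K (v s)) with (/ (eps * K (v s))).
  - exact (inverse_derivative J' _ S sg HJ' HS Hsg Hpos I v Hv s Hs).
  - pose proof (Hneq0 (v s) (proj1 (proj2 Hv s Hs))).
    destruct Heps as [-> | ->]; field; easy.
Qed.

Lemma quadratures_nonconstant (I : R -> Prop) (S u v : R -> R) :
  quadratures eps K J' I S u v -> exists s1 s2, I s1 /\ I s2 /\ v s1 <> v s2.
Proof.
  intros [_ [Hv _]].
  assert (HJ' : is_open_interval J') by apply HK.
  destruct (open_interval_inhabited J' HJ') as [w Hw].
  destruct (open_radius J' w (open_interval_open J' HJ') Hw) as [e He].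
  pose proof (cond_pos e).
  destruct (proj1 Hv w Hw) as [H1 E1].
  destruct (proj1 Hv (w + e) (He (w + e) ltac:(lra))) as [H2 E2].
  (* [v] takes every value in [J'], in particular the distinct values [w] and [w + e]. *)
  exists (S w), (S (w + e)); rewrite E1, E2; repeat split; auto.
  intros Heq; lra.
Qed.

Lemma quadratures_curve_with_momentum (I : R -> Prop) (S u v : R -> R) :
  quadratures eps K J' I S u v ->
  curve_with_momentum eps K J' I (curve_of_uv u v).
Proof.
  intros HQ.
  destruct (quadratures_derive I S u v HQ) as [_ [HvJ [Hu Hv]]].
  assert (Hspeed : unit_speed_on eps I (curve_of_uv u v)).
  { intros s Hs.
    destruct (curve_of_uv_derive u v s _ _ (Hu s Hs) (Hv s Hs)) as [D E].
    split; [exact D |]; rewrite E; unfold g; simpl; field.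
    apply Hneq0, HvJ, Hs. }
  split; [exact Hspeed |]; split; [| split].
  - intros He s Hs; destruct (Hspeed s Hs) as [D ->]; split; [exact D | lra].
  - intros He s Hs; destruct (Hspeed s Hs) as [D ->]; split; [exact D | lra].
  - intros s Hs; rewrite v_coord_curve_of_uv; split; [apply HvJ, Hs |].
    apply is_derive_unique, (is_derive_ext u); [| apply Hu, Hs].
    intros t; symmetry; apply u_coord_curve_of_uv.
Qed.

Lemma quadratures_curvature (I : R -> Prop) (S u v : R -> R) (s : R) :
  quadratures eps K J' I S u v -> I s ->
  has_curvature_at (curve_of_uv u v) s (kappa (v s)).
Proof.
  intros HQ Hs.
  destruct (quadratures_derive I S u v HQ) as [HI [HvJ [Hu Hv]]].
  pose proof (Hneq0 (v s) (HvJ s Hs)) as Hn.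
  pose proof (Hv s Hs) as Dv.
  pose proof (momentum_function_derive (v s) (HvJ s Hs)) as DK.
  set (du := fun t => K (v t)).
  set (dv := fun t => eps / K (v t)).
  assert (Ddu : is_derive du s (kappa (v s) * K (v s))).
  { unfold du; auto_derive.
    - repeat split; eexists; eassumption.
    - rewrite (is_derive_unique (fun x : R => K x) _ _ DK),
        (is_derive_unique (fun x : R => v x) _ _ Dv).
      destruct Heps as [-> | ->]; field; easy. }
  assert (Ddv : is_derive dv s (- eps * kappa (v s) / K (v s))).
  { unfold dv; auto_derive.
    - repeat split; try (eexists; eassumption); easy.
    - rewrite (is_derive_unique (fun x : R => K x) _ _ DK),
        (is_derive_unique (fun x : R => v x) _ _ Dv).
      destruct Heps as [-> | ->]; field; easy. }
  (* The change of coordinates is linear, so the velocity is again of the form [curve_of_uv]. The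
     equality is known on [I] only, and openness of [I] lets it be differentiated at [s]. *)
  assert (Hvel : forall t, I t -> curve_of_uv du dv t = velocity (curve_of_uv u v) t).
  { intros t Ht; symmetry.
    apply (curve_of_uv_derive u v t _ _ (Hu t Ht) (Hv t Ht)). }
  assert (HIs : locally s I) by (apply open_interval_open; easy).
  destruct (curve_of_uv_derive du dv s _ _ Ddu Ddv) as [[D1 D2] E].
  unfold has_curvature_at, normal; rewrite <- (Hvel s Hs).
  split; [split |].
  - revert D1; apply ex_derive_ext_loc, (filter_imp I); [| exact HIs].
    intros t Ht; now rewrite Hvel.
  - revert D2; apply ex_derive_ext_loc, (filter_imp I); [| exact HIs].
    intros t Ht; now rewrite Hvel.
  - transitivity (velocity (curve_of_uv du dv) s).
    + unfold velocity at 1 3; f_equal;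
        apply Derive_ext_loc, (filter_imp I); try exact HIs;
        intros t Ht; now rewrite Hvel.
    + rewrite E; unfold curve_of_uv, du, dv; simpl.
      f_equal; field; easy.
Qed.

(** * The converse: recovering the quadratures from a curve, and uniqueness *)

Lemma curve_with_momentum_derive (I : R -> Prop) (gam : R -> plane) :
  curve_with_momentum eps K J' I gam ->
  antiderivative_on I (fun s => K (v_coord (gam s))) (fun s => u_coord (gam s)) /\
  antiderivative_on I (fun s => eps / K (v_coord (gam s)))
    (fun s => v_coord (gam s)).
Proof.
  intros [Hspeed [_ [_ Hmom]]].
  assert (Hd : forall s, I s ->
    is_derive (fun t => u_coord (gam t)) s (K (v_coord (gam s))) /\
    is_derive (fun t => v_coord (gam t)) s (eps / K (v_coord (gam s)))).
  { intros s Hs.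
    destruct (Hspeed s Hs) as [[D1 D2] E], (Hmom s Hs) as [HvJ HM].
    pose proof (Hneq0 _ HvJ) as Hn.
    apply Derive_correct in D1; apply Derive_correct in D2.
    unfold velocity, g in E; simpl in E.
    set (a := Derive (fun t => fst (gam t)) s) in *.
    set (b := Derive (fun t => snd (gam t)) s) in *.
    assert (Du : is_derive (fun t => u_coord (gam t)) s (b + a)).
    { apply (is_derive_plus (fun t => snd (gam t)) (fun t => fst (gam t)));
        assumption. }
    assert (Dv : is_derive (fun t => v_coord (gam t)) s (b - a)).
    { apply (is_derive_minus (fun t => snd (gam t)) (fun t => fst (gam t)));
        assumption. }
    assert (HM' : b + a = K (v_coord (gam s)))
      by (rewrite <- HM; symmetry; apply is_derive_unique, Du).
    rewrite <- HM' in *; split; [exact Du |].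
    (* Unit speed factors as [(b - a) * (b + a) = eps], and [b + a] is the nonzero momentum. *)
    replace (eps / (b + a)) with (b - a); [exact Dv |].
    rewrite <- E; field; exact Hn. }
  split; intros s Hs; apply Hd, Hs.
Qed.

(** Here the inversion runs the other way: [v] is strictly monotone along the curve, since
    [v' = eps / K(v)] has constant sign. So [S] is defined as the inverse of [v], on the set [J1] of
    values of [v]. *)
Lemma curve_with_momentum_by_quadratures (I : R -> Prop) (gam : R -> plane) :
  is_open_interval I -> curve_with_momentum eps K J' I gam ->
  exists (J1 : R -> Prop) (S : R -> R),
    is_open_interval J1 /\ subset J1 J' /\
    quadratures eps K J1 I S
      (fun s => u_coord (gam s)) (fun s => v_coord (gam s)).
Proof.
  intros HI Hgam.
  destruct (curve_with_momentum_derive I gam Hgam) as [Hu Hv].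
  destruct Hgam as [_ [_ [_ Hmom]]].
  set (v := fun s => v_coord (gam s)) in *.
  destruct momentum_function_sign as [sg [Hsg Hpos]].
  assert (Hpos' : forall s, I s -> 0 < sg * (eps / K (v s))).
  { intros s Hs; destruct (Hmom s Hs) as [HvJ _].
    pose proof (Hpos _ HvJ) as Hp; pose proof (Hneq0 _ HvJ) as Hn.
    fold (v s) in Hp, Hn.
    replace (sg * (eps / K (v s))) with (/ (sg * (eps * K (v s))));
      [now apply Rinv_0_lt_compat |].
    destruct Heps as [-> | ->], Hsg as [-> | ->]; field; easy. }
  destruct (strict_mono_inverse_exists I _ v sg HI Hv Hpos') as [S HS].
  set (J1 := fun w => exists s, I s /\ v s = w) in HS.
  assert (HJ1 : subset J1 J') by (intros w [s [Hs <-]]; apply Hmom, Hs).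
  exists J1, S; split.
  { exact (inverse_domain_open_interval I _ v sg HI Hv Hsg Hpos' J1 S HS). }
  split; [exact HJ1 |]; split; [| split; [| exact Hu]].
  - intros w Hw.
    pose proof (inverse_derivative I _ v sg HI Hv Hsg Hpos' J1 S HS w Hw) as D.
    destruct (proj2 HS w Hw) as [_ E].
    change (is_derive S w (/ (eps / K (v (S w))))) in D; rewrite E in D.
    replace (eps * K w) with (/ (eps / K w)); [exact D |].
    pose proof (Hneq0 w (HJ1 w Hw)).
    destruct Heps as [-> | ->]; field; easy.
  (* [inverse_on] is symmetric: exchanging its two halves makes [v] the inverse of [S]. *)
  - destruct HS; split; assumption.
Qed.

(* Along gam, S(v) has derivative eps K * eps / K = 1, so S(v(s)) = s + c. *)
Lemma curve_with_momentum_unique (I : R -> Prop) (S u v : R -> R)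
    (I2 : R -> Prop) (gam : R -> plane) :
  quadratures eps K J' I S u v -> is_open_interval I2 ->
  curve_with_momentum eps K J' I2 gam ->
  exists c d : R, forall s : R, I2 s ->
    I (s + c) /\ gam s = translate_u d (curve_of_uv u v (s + c)).
Proof.
  intros [HS [Hinv Hu]] HI2 Hgam.
  destruct (curve_with_momentum_derive I2 gam Hgam) as [Hu2 Hv2].
  destruct Hgam as [_ [_ [_ Hmom]]].
  set (w := fun s => v_coord (gam s)) in *.
  set (u2 := fun s => u_coord (gam s)) in *.
  assert (HwJ : forall s, I2 s -> J' (w s)) by (intros s Hs; apply Hmom, Hs).
  destruct (antiderivative_zero_constant I2 (fun s => S (w s) - s) HI2)
    as [c Hc].
  { intros s Hs.
    pose proof (HS _ (HwJ s Hs)) as DS; pose proof (Hv2 s Hs) as Dw.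
    auto_derive.
    - repeat split; eexists; eassumption.
    - rewrite (is_derive_unique (fun x : R => S x) _ _ DS),
        (is_derive_unique (fun x : R => w x) _ _ Dw).
      fold (w s); pose proof (Hneq0 _ (HwJ s Hs)).
      destruct Heps as [-> | ->]; field; easy. }
  assert (Hshift : forall s, I2 s -> I (s + c) /\ v (s + c) = w s).
  { intros s Hs; destruct (proj1 Hinv _ (HwJ s Hs)) as [HI E].
    replace (s + c) with (S (w s)) by (specialize (Hc s Hs); simpl in Hc; lra).
    split; assumption. }
  (* After the shift by [c] both curves have the same [v], hence the same [u' = K(v)]. *)
  destruct (antiderivative_zero_constant I2 (fun s => u2 s - u (s + c)) HI2)
    as [d Hd].
  { intros s Hs; destruct (Hshift s Hs) as [HI E].
    pose proof (Hu2 s Hs) as D2; pose proof (Hu _ HI) as D.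
    auto_derive.
    - repeat split; eexists; eassumption.
    - rewrite (is_derive_unique (fun x : R => u2 x) _ _ D2),
        (is_derive_unique (fun x : R => u x) _ _ D), E.
      unfold w; ring. }
  (* Adding [d / 2] to both [x] and [y] raises [u = y + x] by [d] and leaves [v] unchanged. *)
  exists c, (d / 2); intros s Hs.
  destruct (Hshift s Hs) as [HI E]; split; [exact HI |].
  specialize (Hd s Hs); simpl in Hd; unfold u2, w in Hd, E.
  unfold translate_u, curve_of_uv; simpl.
  rewrite (surjective_pairing (gam s)).
  unfold u_coord, v_coord in Hd, E; f_equal; lra.
Qed.

End Momentum.

Theorem theorem2p2 (J : R -> Prop) (kappa : R -> R)
    (HJ : is_open_interval J)
    (Hkappa : forall w : R, J w -> continuous kappa w) :
  (* |v| is the pseudodistance to the u-axis along horizontals or verticals *)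
  (forall P P' : plane, on_u_axis P' ->
     same_horizontal P P' \/ same_vertical P P' ->
     Rabs (v_coord P) = delta P P')
  /\
  forall eps : R, eps = 1 \/ eps = -1 ->
  (* an admissible momentum function exists near every point of J *)
  (forall v0 : R, J v0 -> exists (J' : R -> Prop) (K : R -> R),
     J' v0 /\ momentum_function eps J kappa J' K)
  /\
  forall (J' : R -> Prop) (K : R -> R), momentum_function eps J kappa J' K ->
  (* the quadratures can be carried out, for any choice of s(v) *)
  (exists S : R -> R, antiderivative_on J' (fun w => eps * K w) S)
  /\
  (forall S : R -> R, antiderivative_on J' (fun w => eps * K w) S ->
     exists (I : R -> Prop) (u v : R -> R), quadratures eps K J' I S u v)
  /\
  (* every outcome is a curve with the required properties *)
  (forall (I : R -> Prop) (S u v : R -> R), quadratures eps K J' I S u v ->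
     is_open_interval I
     /\ (forall s : R, I s -> u_coord (curve_of_uv u v s) = u s
                              /\ v_coord (curve_of_uv u v s) = v s)
     /\ (exists s1 s2 : R, I s1 /\ I s2 /\ v s1 <> v s2)
     /\ curve_with_momentum eps K J' I (curve_of_uv u v)
     /\ (forall s : R, I s ->
           has_curvature_at (curve_of_uv u v) s (kappa (v s))))
  /\
  (* every curve with momentum K(v) is locally obtained by the procedure *)
  (forall (I : R -> Prop) (gam : R -> plane), is_open_interval I ->
     curve_with_momentum eps K J' I gam ->
     forall s0 : R, I s0 ->
     exists (I1 J1 : R -> Prop) (S : R -> R),
       is_open_interval I1 /\ subset I1 I /\ I1 s0 /\
       is_open_interval J1 /\ subset J1 J' /\
       quadratures eps K J1 I1 S
         (fun s => u_coord (gam s)) (fun s => v_coord (gam s)))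
  /\
  (* uniqueness up to translations in the u-direction and in s *)
  (forall (I : R -> Prop) (S u v : R -> R), quadratures eps K J' I S u v ->
     forall (I2 : R -> Prop) (gam : R -> plane), is_open_interval I2 ->
     curve_with_momentum eps K J' I2 gam ->
     exists c d : R, forall s : R, I2 s ->
       I (s + c) /\ gam s = translate_u d (curve_of_uv u v (s + c))).
Proof.
  split; [exact pseudodistance_to_u_axis |].
  intros eps Heps; split.
  { intros v0 H0; apply (momentum_function_exists eps J kappa v0); easy. }
  intros J' K HK.
  split; [exact (arc_parameter_exists eps J kappa J' K Heps HK) |].
  split; [exact (quadratures_exist eps J kappa J' K Heps HK) |].
  split; [| split].
  - intros I S u v HQ.
    split; [apply (quadratures_derive eps J kappa J' K Heps HK I S u v HQ) |].
    split.
    { intros s _; split; [apply u_coord_curve_of_uv | apply v_coord_curve_of_uv]. }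
    split; [exact (quadratures_nonconstant eps J kappa J' K HK I S u v HQ) |].
    split.
    { exact (quadratures_curve_with_momentum eps J kappa J' K Heps HK I S u v HQ). }
    intros s Hs.
    exact (quadratures_curvature eps J kappa J' K Heps HK I S u v s HQ Hs).
  - intros I gam HI Hgam s0 Hs0.
    destruct (curve_with_momentum_by_quadratures eps J kappa J' K Heps HK I gam
      HI Hgam) as [J1 [S HS]].
    (* No shrinking around [s0] is required: the procedure yields the curve on all of [I]. *)
    exists I, J1, S.
    split; [exact HI |]; split; [intros t Ht; exact Ht |]; split; easy.
  - intros I S u v HQ I2 gam.
    exact (curve_with_momentum_unique eps J kappa J' K Heps HK I S u v I2 gam HQ).
Qed.
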